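(* Let $\mathcal V,\mathcal W,a_\varepsilon,f_\varepsilon,J_\varepsilon,u_\varepsilon,q_\varepsilon,j,\mathcal L$ be as in the context. (i) Let $\ell_1:\mathbb R^+\to\mathbb R^+$ with $\lim_{\varepsilon\searrow0}\ell_1(\varepsilon)=0$, and assume that the limits $$\mathcal R^{(1)}:=\lim_{\varepsilon\searrow0}\frac{\mathcal L(\varepsilon,u_0,q_\varepsilon)-\mathcal L(\varepsilon,u_0,q_0)}{\ell_1(\varepsilon)},\qquad \partial^{(1)}_\ell\mathcal L:=\lim_{\varepsilon\searrow0}\frac{\mathcal L(\varepsilon,u_0,q_0)-\mathcal L(0,u_0,q_0)}{\ell_1(\varepsilon)}$$ exist. Then $j(\varepsilon)=j(0)+\ell_1(\varepsilon)(\mathcal R^{(1)}+\partial^{(1)}_\ell\mathcal L)+o(\ell_1(\varepsilon))$ as $\varepsilon\searrow0$. (ii) Let $\ell_2:\mathbb R^+\to\mathbb R^+$ with $\lim_{\varepsilon\searrow0}\ell_2(\varepsilon)/\ell_1(\varepsilon)=0$. Assume that the assumption in (i) holds and that the limits $$\mathcal R^{(2)}:=\lim_{\varepsilon\searrow0}\frac{\mathcal L(\varepsilon,u_0,q_\varepsilon)-\mathcal L(\varepsilon,u_0,q_0)-\ell_1(\varepsilon)\mathcal R^{(1)}}{\ell_2(\varepsilon)},\qquad \partial^{(2)}_\ell\mathcal L:=\lim_{\varepsilon\searrow0}\frac{\mathcal L(\varepsilon,u_0,q_0)-\mathcal L(0,u_0,q_0)-\ell_1(\varepsilon)\partial^{(1)}_\ell\mathcal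 L}{\ell_2(\varepsilon)}$$ exist. Then $j(\varepsilon)=j(0)+\ell_1(\varepsilon)(\mathcal R^{(1)}+\partial^{(1)}_\ell\mathcal L)+\ell_2(\varepsilon)(\mathcal R^{(2)}+\partial^{(2)}_\ell\mathcal L)+o(\ell_2(\varepsilon))$.
   Context: $\mathcal V,\mathcal W$ are real Hilbert spaces. For all small $\varepsilon\ge0$, $a_\varepsilon$ is a bilinear form on $\mathcal V\times\mathcal W$, $f_\varepsilon$ a linear form on $\mathcal W$, and $u_\varepsilon\in\mathcal V$ is the unique solution of $a_\varepsilon(u_\varepsilon,\varphi)=f_\varepsilon(\varphi)$ for all $\varphi\in\mathcal W$; it is assumed that $u_\varepsilon-u_0\in\mathcal W$ for all $\varepsilon$. $J_\varepsilon:\mathcal V\to\mathbb R$ is a functional differentiable at $u_0$, and $j(\varepsilon)=J_\varepsilon(u_\varepsilon)$. The Lagrangian is $\mathcal L(\varepsilon,u,v)=J_\varepsilon(u)+a_\varepsilon(u,v)-f_\varepsilon(v)$ for $u\in\mathcal V$, $v\in\mathcal W$. It is assumed that for all $(\varphi,q)\in\mathcal V\times\mathcal W$ and $\varepsilon\ge0$ the function $s\mapsto\partial_u\mathcal L(\varepsilon,su_\varepsilon+(1-s)u_0,q)(\varphi)$, $[0,1]\to\mathbb R$, is (well defined and) continuously differentiable. The averaged adjoint $q_\varepsilon\in\mathcal W$ is the (assumed unique and existing) solution of $\int_0^1\partial_u\mathcal L(\varepsilon,su_\varepsilon+(1-s)u_0,q_\varepsilon)(\varphi)\,ds=0$ for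 all $\varphi\in\mathcal V$; $q_0$ is the solution for $\varepsilon=0$. *)

(* Defs.v *)
From HB Require Import structures.
From mathcomp Require Export all_boot all_order all_algebra.
From mathcomp Require Export sesquilinear.
From mathcomp Require Export all_classical all_reals all_analysis.
Export Order.TTheory GRing.Theory Num.Theory.
Export numFieldNormedType.Exports.

#[export] Set Implicit Arguments.
#[export] Unset Strict Implicit.
#[export] Unset Printing Implicit Defensive.

#[global] Open Scope classical_set_scope.
#[global] Open Scope ring_scope.

(* A real Hilbert space is a complete normed module whose norm comes from a
   symmetric positive definite bilinear form. *)
HB.mixin Record isHilbert (R : realType) (H : Type)
    of CompleteNormedModule R H := {
  inner : {dot H for (@idfun R)};
  innerxx : forall x : H, inner x x = `|x| ^+ 2
}.

#[short(type="hilbertType")]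
HB.structure Definition Hilbert (R : realType) :=
  {H of CompleteNormedModule R H & isHilbert R H}.

Section AveragedAdjoint.
Context {R : realType} {V W : hilbertType R}.
Variable J : R -> V -> R.
Variable a : R -> {bilinear V -> W -> R | *%R & *%R}.
Variable f : R -> {scalar W}.

Definition state_solution (e : R) (u : V) : Prop :=
  forall phi : W, a e u phi = f e phi.

Definition reduced_cost (u : R -> V) (e : R) : R := J e (u e).

Definition lagrangian (e : R) (u : V) (v : W) : R :=
  J e u + a e u v - f e v.

Definition derivable_lagrangian (e : R) (x : V) (q : W) (phi : V) : Prop :=
  derivable (fun y : V => lagrangian e y q) x phi.

(* The partial derivative in u, applied to the direction phi.  It is a Gateaux
   derivative: the forms [a e] are not assumed bounded, so that the Lagrangian
   need not be Frechet differentiable in u. *)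
Definition dlagrangian (e : R) (x : V) (q : W) (phi : V) : R :=
  'D_phi (fun y : V => lagrangian e y q) x.

Definition segment_pt (x0 x1 : V) (s : R) : V := s *: x1 + (1 - s) *: x0.

Definition averaged_adjoint (u : R -> V) (e : R) (q : W) : Prop :=
  forall phi : V,
    \int[lebesgue_measure]_(s in `[0, 1])
      dlagrangian e (segment_pt (u 0) (u e) s) q phi = 0.

End AveragedAdjoint.

(* C^1 on the closed interval [x, y]; the values of g outside [x, y] are
   irrelevant, and the derivatives at x and y are one-sided. *)
Definition C1_on_itv {R : realType} (x y : R) (g : R -> R) : Prop :=
  exists dg : R -> R,
    (forall s, s \in `[x, y] ->
       (g t - g s) / (t - s) @[t --> within `[x, y] s^'] --> dg s) /\
    {within `[x, y], continuous dg}.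

(* Main.v *)
(** The function [s |-> L(e, s u_e + (1 - s) u_0, q_e)] has derivative
    [d_u L(e, s u_e + (1 - s) u_0, q_e)(u_e - u_0)], whose integral over [0, 1]
    vanishes by the averaged adjoint equation tested with [u_e - u_0].  Hence
    [L(e, u_0, q_e) = L(e, u_e, q_e)], and this is [j(e)] by the state equation.
    The expansions follow by splitting [L(e, u_0, q_e) - L(0, u_0, q_0)] at
    [L(e, u_0, q_0)]. *)
Require Import Defs.
From mathcomp Require Import ring.

(** Multiplying the difference quotient, which converges, by [t - s], which tends to 0, gives
    [g t - g s --> 0]. This supplies the continuous integrand that the fundamental theorem of
    calculus asks for. *)
Lemma continuous_C1_on_itv (R : realType) (x y : R) (g : R -> R) :
  C1_on_itv x y g -> {within `[x, y], continuous g}.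
Proof.
move=> [dg [g_dg _]]; apply/subspace_continuousP => s xys.
have id_s : t - s @[t --> within `[x, y] s^'] --> 0.
  rewrite -(subrr s); apply: cvgB; last exact: cvg_cst.
  by apply: cvg_within_filter; apply: cvg_within_filter; exact: cvg_id.
have /cvgrPdist_lt g_s : (g t - g s) / (t - s) * (t - s)
    @[t --> within `[x, y] s^'] --> dg s * 0.
  exact: cvgM (g_dg s xys) id_s.
apply/cvgrPdist_lt => eps eps_gt0.
(* Both [within] filters are unfolded to [nbhs s]: the punctured one says nothing at [t = s], where
   the bound is trivial. *)
suff: \forall t \near s, t \in `[x, y] -> `|g s - g t| < eps by [].
have : \forall t \near s, t != s -> t \in `[x, y] ->
    `|dg s * 0 - (g t - g s) / (t - s) * (t - s)| < eps := g_s eps eps_gt0.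
apply: filterS => t gt txy.
have [->|ts] := eqVneq t s; first by rewrite subrr normr0.
move: (gt ts txy).
by rewrite mulr0 divfK ?subr_eq0// sub0r normrN distrC.
Qed.

(** Shifting the parameter by [h] moves the segment point by [h *: (x1 - x0)]. As the quotients
    agree as functions of [h], derivability and the derivative both transfer, and a Gateaux
    derivative of [G] suffices. *)
Lemma segment_quotient (R : realType) (V : hilbertType R) (G : V -> R)
    (x0 x1 : V) (s : R) :
  (fun h : R => h^-1 *: (((G \o segment_pt x0 x1) \o shift s) (h *: 1) -
     (G \o segment_pt x0 x1) s)) =
  (fun h : R => h^-1 *: ((G \o shift (segment_pt x0 x1 s)) (h *: (x1 - x0)) -
     G (segment_pt x0 x1 s))).
Proof.
apply/funext => h /=; congr (_ *: (G _ - _)).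
rewrite /segment_pt [h *: 1]mulr1 opprD addrCA !scalerDl scalerBr scaleNr.
by rewrite addrACA addrA.
Qed.

Lemma integral_derive_segment (R : realType) (V : hilbertType R) (G : V -> R)
    (x0 x1 : V) (D : V -> R := fun x => 'D_(x1 - x0) G x) :
  (forall s, s \in `[0, 1] -> derivable G (segment_pt x0 x1 s) (x1 - x0)) ->
  {within `[0, 1], continuous (D \o segment_pt x0 x1)} ->
  \int[lebesgue_measure]_(s in `[0, 1]) D (segment_pt x0 x1 s) = G x1 - G x0.
Proof.
move=> dG cD.
have dF : {in `[0, 1], forall s : R, derivable (G \o segment_pt x0 x1) s 1}.
  by move=> s s01; rewrite /derivable segment_quotient; exact: dG.
(* The one-sided continuity of the primitive at 0 and 1 comes from its two-sided derivability
   there. *)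
have [_ F0 F1] :=
  (continuous_within_itvP _ ltr01).1 (derivable_within_continuous dF).
rewrite /Rintegral (@continuous_FTC2 _ _ (G \o segment_pt x0 x1) _ _ ltr01)//.
- by rewrite /= /segment_pt !scale1r !scale0r subrr subr0 scale0r scale1r
    addr0 add0r.
- by split=> // s s01; apply: dF; exact: subset_itv_oo_cc s01.
- by move=> s s01; rewrite derive1E /derive segment_quotient.
Qed.

(** The error [h - (k + l * c)] equals [(g / l - c) * l] near 0, and its first factor tends to 0. *)
Lemma eqaddo_cvg_ratio (R : realType) (h k g l : R -> R) (c : R) :
  (forall e, 0 < e -> 0 < l e) ->
  (\forall e \near 0^'+, h e = k e + g e) ->
  g e / l e @[e --> 0^'+] --> c ->
  h = (fun e => k e + l e * c) +o_ (0^'+) l.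
Proof.
move=> l_gt0 hE /cvgrPdist_le gl; apply/eqaddoP => eps eps_gt0.
have := gl eps eps_gt0.
apply: filterS3 hE (nbhs_right_gt 0) => e hEe e_gt0 gle.
have le_gt0 := l_gt0 e e_gt0.
rewrite -[(_ - _) e]/(h e - (k e + l e * c)) hEe [k e + _]addrC addrKA.
by rewrite -(divfK (lt0r_neq0 le_gt0) (g e)) [l e * c]mulrC -mulrBl normrM
  distrC ler_wpM2r.
Qed.

Lemma lagrangian_adjoint (R : realType) (V W : hilbertType R)
    (a : R -> {bilinear V -> W -> R | *%R & *%R}) (f : R -> {scalar W})
    (J : R -> V -> R) (u : R -> V) (e : R) (v : W) :
  state_solution a f e (u e) ->
  (forall s, s \in `[0, 1] ->
     derivable_lagrangian J a f e (segment_pt (u 0) (u e) s) v (u e - u 0)) ->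
  C1_on_itv 0 1
    (fun s => dlagrangian J a f e (segment_pt (u 0) (u e) s) v (u e - u 0)) ->
  averaged_adjoint J a f u e v ->
  lagrangian J a f e (u 0) v = reduced_cost J u e.
Proof.
move=> u_state dL /continuous_C1_on_itv cL /(_ (u e - u 0)).
rewrite (integral_derive_segment dL cL) => /subr0_eq <-.
by rewrite /lagrangian u_state addrK.
Qed.

Theorem proposition2p4 (R : realType) (V W : hilbertType R)
  (* V and W live in a common ambient vector space, so that membership of an
     element of V in W makes sense *)
  (E : lmodType R) (iV : {linear V -> E}) (iW : {linear W -> E})
  (iV_inj : injective iV) (iW_inj : injective iW)
  (a : R -> {bilinear V -> W -> R | *%R & *%R})
  (f : R -> {scalar W})
  (J : R -> V -> R) (u : R -> V) (q : R -> W)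
  (* "for all small e >= 0" is "for all 0 <= e < ebar" *)
  (ebar : R) (ebar_gt0 : 0 < ebar)
  (u_state : forall e, 0 <= e < ebar -> unique (state_solution a f e) (u e))
  (u_diff : forall e, 0 <= e < ebar -> exists w : W, iW w = iV (u e - u 0))
  (J_diff : forall e, 0 <= e < ebar -> differentiable (J e) (u 0))
  (dL_def : forall (phi : V) (v : W) e s, 0 <= e < ebar -> 0 <= s <= 1 ->
     derivable_lagrangian J a f e (segment_pt (u 0) (u e) s) v phi)
  (dL_C1 : forall (phi : V) (v : W) e, 0 <= e < ebar ->
     C1_on_itv 0 1
       (fun s => dlagrangian J a f e (segment_pt (u 0) (u e) s) v phi))
  (q_adj : forall e, 0 <= e < ebar ->
     unique (averaged_adjoint J a f u e) (q e)) :
  let L := lagrangian J a f in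
  let j := reduced_cost J u in
  (forall (l1 : R -> R) (R1 dL1 : R),
     (forall e, 0 < e -> 0 < l1 e) ->
     l1 e @[e --> 0^'+] --> 0 ->
     (L e (u 0) (q e) - L e (u 0) (q 0)) / l1 e @[e --> 0^'+] --> R1 ->
     (L e (u 0) (q 0) - L 0 (u 0) (q 0)) / l1 e @[e --> 0^'+] --> dL1 ->
     j = (fun e => j 0 + l1 e * (R1 + dL1)) +o_ (0^'+) l1) /\
  (forall (l1 l2 : R -> R) (R1 dL1 R2 dL2 : R),
     (forall e, 0 < e -> 0 < l1 e) ->
     l1 e @[e --> 0^'+] --> 0 ->
     (L e (u 0) (q e) - L e (u 0) (q 0)) / l1 e @[e --> 0^'+] --> R1 ->
     (L e (u 0) (q 0) - L 0 (u 0) (q 0)) / l1 e @[e --> 0^'+] --> dL1 ->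
     (forall e, 0 < e -> 0 < l2 e) ->
     l2 e / l1 e @[e --> 0^'+] --> 0 ->
     (L e (u 0) (q e) - L e (u 0) (q 0) - l1 e * R1) / l2 e
       @[e --> 0^'+] --> R2 ->
     (L e (u 0) (q 0) - L 0 (u 0) (q 0) - l1 e * dL1) / l2 e
       @[e --> 0^'+] --> dL2 ->
     j = (fun e => j 0 + l1 e * (R1 + dL1) + l2 e * (R2 + dL2))
       +o_ (0^'+) l2).
Proof.
move=> L j.
have jL e : 0 <= e < ebar -> j e = L e (u 0) (q e).
  move=> e_ebar; apply/esym/lagrangian_adjoint.
  - exact: (u_state e e_ebar).1.
  - by move=> s; rewrite in_itv; exact: dL_def.
  - exact: dL_C1.
  - exact: (q_adj e e_ebar).1.
(* [jL] is used at [e] and also at 0, where it gives [j 0 = L 0 (u 0) (q 0)]. *)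
have jE : \forall e \near 0^'+, j e = j 0 +
    (L e (u 0) (q e) - L e (u 0) (q 0) + (L e (u 0) (q 0) - L 0 (u 0) (q 0))).
  apply: filterS2 (nbhs_right_gt 0) (nbhs_right_lt ebar_gt0) => e e_gt0 e_lt.
  rewrite (jL e) ?(ltW e_gt0)// (jL 0) ?lexx//; ring.
split=> [l1 R1 dL1 l1_gt0 _ R1P dL1P|].
  apply: (eqaddo_cvg_ratio l1_gt0 jE).
  under eq_fun do rewrite mulrDl.
  exact: cvgD.
move=> l1 l2 R1 dL1 R2 dL2 _ _ _ _ l2_gt0 _ R2P dL2P.
(* The first-order terms move from the remainder [g] into the known part [k], so that [g] is of
   order [l2]. *)
apply: (@eqaddo_cvg_ratio _ _ (fun e => j 0 + l1 e * (R1 + dL1))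
  (fun e => L e (u 0) (q e) - L e (u 0) (q 0) - l1 e * R1 +
    (L e (u 0) (q 0) - L 0 (u 0) (q 0) - l1 e * dL1)) l2 (R2 + dL2)) => //.
  apply: filterS jE => e ->; ring.
under eq_fun do rewrite mulrDl.
exact: cvgD.
Qed.
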